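(* Let $(L,m)$ be a quasi-local principally generated C-lattice domain. The following statements are equivalent. (1) $L$ is an OAFL. (2) $L$ is a TAFL. (3) $L$ is a COAFL. (4) $L$ is a CTAFL that satisfies the ascending chain condition on prime elements. (5) $\dim(L)\leq 1$ and $L$ is a POAFL. (6) $\dim(L)\leq 1$ and $L$ is a PTAFL. (7) $m^2$ is comparable and $\bigwedge_{n\in\mathbb{N}} m^n=0$.
   Context: A multiplicative lattice is a set $L$ with a commutative associative multiplication and a partial order $\leq$ such that $(L,\leq)$ is a complete lattice with greatest element $1$ and least element $0$, and such that $1x=x$ and $x(\bigvee E)=\bigvee\{xe\mid e\in E\}$ for all $x\in L$ and $E\subseteq L$. An element $a\in L$ is compact if for each $F\subseteq L$ with $a\leq\bigvee F$ there is a finite $E\subseteq F$ with $a\leq\bigvee E$. A subset is multiplicatively closed if it contains $1$ and is closed under products. $L$ is a C-lattice if there is a multiplicatively closed subset $C\subseteq L$ of compact elements such that every element of $L$ is a join of elements of $C$. For $a,b\in L$, $(a:b)=\bigvee\{x\in L\mid xb\leq a\}$. An element $e\in L$ is principal if $a\wedge be=((a:e)\wedge b)e$ and $((a\vee be):e)=(a:e)\vee b$ for all $a,b\in L$. $L$ is principally generated if every element of $L$ is a join of principal elements. An element $a$ is proper if $a<1$; it is comparable if for each $b\in L$, $a\leq b$ or $b\leq a$. A proper element $m$ is maximal if $m<x\leq 1$ implies $x=1$. A proper element $p$ is prime if for all $a,b\in L$, $ab\leq p$ implies $a\leq p$ or $b\leq p$. $L$ is a lattice domain (a C-lattice domain is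 a C-lattice which is a lattice domain) if $0$ is a prime element. $L$ is quasi-local if $1$ is compact and $L$ has a unique maximal element; $(L,m)$ quasi-local means that $m$ is this maximal element. $\dim(L)$ is the supremum of all $n\in\mathbb{N}$ such that there is a strict chain $p_0<p_1<\dots<p_n$ of prime elements of $L$. A proper element $x$ of a C-lattice $L$ is an OA-element ($1$-absorbing prime element) if for all $a,b,c\in L\setminus\{1\}$, $abc\leq x$ implies $ab\leq x$ or $c\leq x$. A proper element $p$ is a TA-element ($2$-absorbing element) if for all $a,b,c\in L$, $abc\leq p$ implies $ab\leq p$ or $bc\leq p$ or $ac\leq p$. An OAFL (resp. COAFL, resp. POAFL) is a C-lattice in which every element (resp. every compact element, resp. every principal element) is a finite product of OA-elements. A TAFL (resp. CTAFL, resp. PTAFL) is a C-lattice in which every element (resp. every compact element, resp. every principal element) is a finite product of TA-elements. In all cases the element $1$ is the empty product. *)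

(* Defs.v *)
From HB Require Import structures.
From mathcomp Require Import all_boot all_order ssrint.
From mathcomp Require Import boolp classical_sets cardinality.
From mathcomp Require Import constructive_ereal.

Set Implicit Arguments.
Unset Strict Implicit.
Unset Printing Implicit Defensive.

Local Open Scope order_scope.
Local Open Scope group_scope.
Local Open Scope classical_set_scope.

(* The order side is a MathComp lattice with \bot = 0 and \top = 1, and the
   multiplication is a MathComp monoid, so that [x * y], [x ^+ n], [1] and
   [\prod] are those of group_scope; [mul_top1] identifies the two units.
   [lattice_complete] covers E = set0, and completeness for infima follows. *)
HB.mixin Record isMultLattice d L
    of Order.TBLattice d L & monoid.Monoid L := {
  mul_commutative : @commutative L L *%g;
  mul_top1 : (\top : L)%O = 1;
  lattice_complete : forall E : set L, supremums E !=set0;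
  mul_supremum : forall (x : L) (E : set L),
    x * supremum (\bot : L)%O E =
    supremum (\bot : L)%O [set x * e | e in E]
}.

#[short(type="multLatticeType")]
HB.structure Definition MultLattice d :=
  { L of isMultLattice d L & Order.TBLattice d L & monoid.Monoid L }.

Section MultLatticeDefs.
Context {d : Order.disp_t} {L : multLatticeType d}.
Implicit Types (a b c e m p x y : L) (E F C : set L).

(* The first argument of supremum (infimum) is its value on set0. *)
Definition bigvee E : L := supremum (\bot : L)%O E.
Definition bigwedge E : L := infimum (\top : L)%O E.

Definition residual a b : L := bigvee [set x | (x * b <= a)%O].

Definition compact_elt a : Prop :=
  forall F, (a <= bigvee F)%O ->
    exists E, [/\ finite_set E, E `<=` F & (a <= bigvee E)%O].

Definition mult_closed C : Prop :=
  C 1 /\ forall x y, C x -> C y -> C (x * y).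

Definition proper_elt a : Prop := (a < 1)%O.

Definition comparable_elt a : Prop := forall b, (a <= b)%O \/ (b <= a)%O.

Definition principal_elt e : Prop :=
  (forall a b, (a `&` (b * e) = (residual a e `&` b) * e)%O) /\
  (forall a b, (residual (a `|` (b * e)) e = residual a e `|` b)%O).

Definition maximal_elt m : Prop :=
  proper_elt m /\ forall x, (m < x)%O -> (x <= 1)%O -> x = 1.

Definition prime_elt p : Prop :=
  proper_elt p /\
  forall a b, (a * b <= p)%O -> (a <= p)%O \/ (b <= p)%O.

Definition OA_elt x : Prop :=
  proper_elt x /\
  forall a b c, a <> 1 -> b <> 1 -> c <> 1 ->
    (a * b * c <= x)%O -> (a * b <= x)%O \/ (c <= x)%O.

Definition TA_elt p : Prop :=
  proper_elt p /\
  forall a b c, (a * b * c <= p)%O ->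
    [\/ (a * b <= p)%O, (b * c <= p)%O | (a * c <= p)%O].

Definition finite_prod_of (P : L -> Prop) x : Prop :=
  exists s : seq L, (forall y, y \in s -> P y) /\ x = \prod_(y <- s) y.

End MultLatticeDefs.

Section MultLatticeClasses.
Context {d : Order.disp_t} (L : multLatticeType d).

Definition C_lattice : Prop :=
  exists C : set L,
    [/\ mult_closed C,
        forall c, C c -> compact_elt c
      & forall x : L, exists2 F, F `<=` C & x = bigvee F].

Definition principally_generated : Prop :=
  forall x : L, exists2 F : set L, F `<=` principal_elt & x = bigvee F.

Definition lattice_domain : Prop := prime_elt (\bot : L)%O.

Definition quasi_local (m : L) : Prop :=
  compact_elt (1 : L) /\ unique maximal_elt m.

Definition prime_chain_length (n : nat) : Prop :=
  exists s : seq L,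
    [/\ size s = n.+1, sorted <%O s & forall p, p \in s -> prime_elt p].

Definition krull_dim : \bar int :=
  supremum -oo%E [set (n%:Z)%:E | n in prime_chain_length].

Definition ACC_primes : Prop :=
  forall p : nat -> L, (forall n, prime_elt (p n)) ->
    (forall n, (p n <= p n.+1)%O) ->
    exists N, forall n, (N <= n)%N -> p n = p N.

Definition OAFL : Prop :=
  C_lattice /\ forall x : L, finite_prod_of OA_elt x.
Definition COAFL : Prop :=
  C_lattice /\ forall x : L, compact_elt x -> finite_prod_of OA_elt x.
Definition POAFL : Prop :=
  C_lattice /\ forall x : L, principal_elt x -> finite_prod_of OA_elt x.

Definition TAFL : Prop :=
  C_lattice /\ forall x : L, finite_prod_of TA_elt x.
Definition CTAFL : Prop :=
  C_lattice /\ forall x : L, compact_elt x -> finite_prod_of TA_elt x.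
Definition PTAFL : Prop :=
  C_lattice /\ forall x : L, principal_elt x -> finite_prod_of TA_elt x.

End MultLatticeClasses.

(* Main.v *)
(** The lattice need not be modular, so the arguments never pass to a quotient by
a prime; they use principal elements, which are compact, generate the lattice
and, when nonzero, can be cancelled.

The key point is that if every compact element is a product of TA-elements,
then every nonzero prime is [m].  Let [0 < p < P] be primes.  Factoring
[h \/ a^3], with [h <= p] and [a <= P] principal and [a] not below [p], shows
[p <= P^2].  It follows that [P] is idempotent in the localization at [P]:
otherwise some principal TA-element [y <= P] is not locally below [P^2], so [P]
is the only prime between [y] and [P], and [y] lies locally above [P^2].  Then a
principal TA-element [t <= p] satisfies [s t = w y^2] with [s] not below [P];
the TA-property gives [w y <= t], and cancelling [t] in [s t <= t y] yields
[s <= P].  If moreover [P] were minimal over [c \/ f] with [c <= p] compact and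
[f] principal, not below [p], then [c \/ f] would locally equal [P], hence be
idempotent, contrary to Nakayama.  As a principal TA-element has at most two
minimal primes, such a [P] exists as soon as there is a prime strictly between
[0] and [m].

If all nonzero primes are [m], nonzero TA-elements contain [m^2], and the last
condition follows from the factorization of principal elements.  Conversely, if
[m^2] is comparable and the powers of [m] meet in [0], take [e <= m] principal,
not below [m^2]; then [m^(k+1) = m e^k], so each nonzero [x <= m^2] is [y e^k]
with [m^2 <= y], and proper elements above [m^2] are OA-elements. *)

Require Import Defs.
From mathcomp Require Import all_boot all_order ssrint.
From mathcomp Require Import boolp classical_sets cardinality.
From mathcomp Require Import constructive_ereal.

Local Open Scope classical_set_scope.

(** * Complete lattices, multiplication and residuals *)

Section MultLatticeTheory.
Set Implicit Arguments.
Unset Strict Implicit.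
Unset Printing Implicit Defensive.
Import Order.TTheory.
Local Open Scope order_scope.
Local Open Scope group_scope.
Context {d : Order.disp_t} {L : multLatticeType d}.
Implicit Types (a b c e f g p q r s t x y z P : L) (E F S : set L).

Lemma supremums_bigvee E : supremums E (bigvee E).
Proof.
rewrite /bigvee /supremum; case: ifPn => [/eqP ->|_]; last first.
  by apply: xgetPex; exact: lattice_complete.
by split=> [x []|x _]; rewrite le0x.
Qed.

Lemma le_bigvee E x : E x -> x <= bigvee E.
Proof. by move=> Ex; have [+ _] := supremums_bigvee E; apply. Qed.

Lemma bigvee_le E y : (forall x, E x -> x <= y) -> bigvee E <= y.
Proof. by move=> Ey; have [_] := supremums_bigvee E; apply. Qed.

Lemma infimums_bigwedge E : infimums E (bigwedge E).
Proof.
rewrite /bigwedge /infimum; case: ifPn => [/eqP ->|_]; last first.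
  apply: xgetPex; exists (bigvee (lbound E)); split.
    by move=> x Ex; apply: bigvee_le => y; apply.
  by move=> y; exact: le_bigvee.
by split=> [x []|x _]; rewrite lex1.
Qed.

Lemma bigwedge_le E x : E x -> bigwedge E <= x.
Proof. by move=> Ex; have [+ _] := infimums_bigwedge E; apply. Qed.

Lemma le_bigwedge E y : (forall x, E x -> y <= x) -> y <= bigwedge E.
Proof. by move=> Ey; have [_] := infimums_bigwedge E; apply. Qed.

Lemma mlC : @commutative L L *%g. Proof. exact: mul_commutative. Qed.

Lemma mlAC x y z : x * y * z = x * z * y.
Proof. by rewrite -!mulgA (mlC y). Qed.

Lemma mlCA x y z : x * (y * z) = y * (x * z).
Proof. by rewrite !mulgA (mlC x). Qed.

Lemma lel1 x : x <= 1. Proof. by rewrite -mul_top1 lex1. Qed.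

Lemma ge1E x : 1 <= x -> x = 1.
Proof. by move=> h; apply/le_anti; rewrite lel1 h. Qed.

Lemma le0E x : x <= \bot -> x = \bot.
Proof. by rewrite lex0 => /eqP. Qed.

Lemma proper_eltP x : proper_elt x <-> x <> 1.
Proof.
by rewrite /proper_elt lt_neqAle lel1 andbT; split=> /eqP.
Qed.

Lemma mul_bigvee x E : x * bigvee E = bigvee [set x * e | e in E].
Proof. exact: mul_supremum. Qed.

Lemma bigvee2 x y : bigvee [set x; y] = x `|` y.
Proof.
apply/le_anti/andP; split.
  by apply: bigvee_le => z [] ->; rewrite (leUl, leUr).
by rewrite leUx !le_bigvee //=; [right|left].
Qed.

Lemma mlUr x y z : x * (y `|` z) = x * y `|` x * z.
Proof.
rewrite -!bigvee2 mul_bigvee; congr bigvee; apply/seteqP; split.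
  by move=> _ [w [->|->] <-]; [left|right].
by move=> w [->|->]; [exists y; first left|exists z; first right].
Qed.

Lemma mlUl x y z : (y `|` z) * x = y * x `|` z * x.
Proof. by rewrite !(mlC _ x) mlUr. Qed.

Lemma mlr0 x : x * \bot = \bot.
Proof.
have e0 : bigvee (set0 : set L) = \bot by rewrite /bigvee supremum0.
by rewrite -e0 mul_bigvee image_set0.
Qed.

Lemma leM2l x y z : y <= z -> x * y <= x * z.
Proof. by move=> /join_idPr <-; rewrite mlUr leUl. Qed.

Lemma leM2r x y z : y <= z -> y * x <= z * x.
Proof. by rewrite !(mlC _ x); exact: leM2l. Qed.

Lemma leM x y z t : x <= y -> z <= t -> x * z <= y * t.
Proof.
by move=> xy zt; apply: le_trans (leM2l y zt); exact: leM2r.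
Qed.

Lemma leMl x y : x * y <= y.
Proof. by rewrite -{2}(mul1g y) leM2r ?lel1. Qed.

Lemma leMr x y : x * y <= x. Proof. by rewrite mlC leMl. Qed.

Lemma le_residual x a b : (x <= residual a b) = (x * b <= a).
Proof.
apply/idP/idP => [h|h]; last exact: le_bigvee.
apply: le_trans (leM2r b h) _.
by rewrite mlC mul_bigvee; apply: bigvee_le => _ [y + <-]; rewrite mlC.
Qed.

Lemma residual_mul_le a b : residual a b * b <= a.
Proof. by rewrite -le_residual. Qed.

Lemma residual1 a : residual a 1 = a.
Proof.
apply/le_anti; rewrite le_residual mulg1 lexx andbT.
by have := residual_mul_le a 1; rewrite mulg1.
Qed.

Lemma residualM a b c : residual a (b * c) = residual (residual a c) b.
Proof.
apply/le_anti; rewrite !le_residual -mulgA residual_mul_le /= mulgA.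
by rewrite -!le_residual.
Qed.

Lemma residual_prime p a b : prime_elt p -> a <= p -> ~ b <= p -> residual a b <= p.
Proof.
move=> [_ pp] ap nbp.
by have [] := pp _ _ (le_trans (residual_mul_le a b) ap).
Qed.

(** * Principal elements *)

Lemma principal1 : principal_elt (1 : L).
Proof. by split=> a b; rewrite !residual1 !mulg1. Qed.

Lemma principalM e f : principal_elt e -> principal_elt f -> principal_elt (e * f).
Proof.
move=> [me je] [mf jf]; split=> a b.
  by rewrite mulgA mf me -mulgA residualM.
by rewrite mulgA residualM jf je residualM.
Qed.

Lemma principalX e n : principal_elt e -> principal_elt (e ^+ n).
Proof.
by move=> he; elim: n => [|n IH]; [exact: principal1|rewrite expgS; exact: principalM].
Qed.

Lemma residual_mulK a e : principal_elt e -> a <= e -> residual a e * e = a.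
Proof.
move=> [me _] /meet_idPl ae.
by have := me a 1; rewrite mul1g ae -mul_top1 meetx1 => <-.
Qed.

Lemma mul_le_joinP t a b e : principal_elt e ->
  t * e <= a `|` b * e -> t <= residual a e `|` b.
Proof. by move=> [_ je]; rewrite -le_residual je. Qed.

(** * Compact elements *)

Lemma compact_join x y : compact_elt x -> compact_elt y -> compact_elt (x `|` y).
Proof.
move=> cx cy F; rewrite leUx => /andP[/cx [A [fA AF xA]] /cy [B [fB BF yB]]].
exists (A `|` B)%classic; split; first by rewrite finite_setU.
  by move=> z [/AF|/BF].
rewrite leUx; apply/andP; split.
  by apply: le_trans xA _; apply: bigvee_le => z Az; apply: le_bigvee; left.
by apply: le_trans yB _; apply: bigvee_le => z Bz; apply: le_bigvee; right.
Qed.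

Lemma compact0 : compact_elt (\bot : L).
Proof. by move=> F _; exists set0; split. Qed.

(** * Zorn arguments: prime avoidance and minimal primes *)

Lemma chain_max (V : set L) (x0 : L) (l : seq L) :
  (forall y, V y -> x0 <= y) -> V x0 -> total_on V (fun y z => y <= z) ->
  (forall y, y \in l -> V y) ->
  exists2 v, V v & forall y, y \in l -> y <= v.
Proof.
move=> x0V Vx0 tot; elim: l => [_|y l IH Vl]; first by exists x0.
have [z zl|v Vv vl] := IH; first by apply: Vl; rewrite inE zl orbT.
have Vy : V y by apply: Vl; rewrite mem_head.
have [yv|vy] := tot _ _ Vy Vv.
  by exists v => // z; rewrite inE => /predU1P[->//|/vl].
by exists y => // z; rewrite inE => /predU1P[->//|/vl zv]; exact: le_trans zv vy.
Qed.

(** By compactness, an [s] below the join of a chain lies below a finite subjoin, hence below one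
    member; so avoiding [S] survives joins of chains and Zorn applies. *)
Lemma exists_max_avoiding S x :
  (forall s, S s -> compact_elt s) -> (forall s, S s -> ~ s <= x) ->
  exists y, [/\ x <= y, forall s, S s -> ~ s <= y
    & forall z, y <= z -> (forall s, S s -> ~ s <= z) -> z = y].
Proof.
move=> cS Sx.
pose Q y := `[< x <= y /\ forall s, S s -> ~ s <= y >].
pose T := {y : L | Q y}.
have [||||t tmax] := @Zorn T (fun u v => val u <= val v).
- by move=> u; exact: lexx.
- by move=> u v w; exact: le_trans.
- by move=> u v uv vu; apply/val_inj/le_anti; rewrite uv vu.
- move=> A totA.
  (* Including [x] covers the empty chain. *)
  pose V : set L := [set y | y = x \/ exists2 u, A u & y = val u].
  have xV y : V y -> x <= y by case=> [->//|[u _ ->]]; have /asboolP[] := valP u.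
  have QV : Q (bigvee V).
    apply/asboolP; split=> [|s Ss sV]; first by apply: le_bigvee; left.
    have [E [/finite_seqP[l ->] lV sl]] := cS _ Ss _ sV.
    have [|||v [vx|[u Au vu]] lv] := @chain_max V x l xV.
    + by left.
    + move=> y z [->|[u Au ->]] [->|[w Aw ->]]; first by left.
      * by left; have /asboolP[] := valP w.
      * by right; have /asboolP[] := valP u.
      * exact: totA.
    + by move=> y yl; exact: lV.
    + by apply: (Sx _ Ss); rewrite -vx; apply: le_trans sl (bigvee_le lv).
    + have /asboolP[_ /(_ _ Ss)] := valP u; apply; rewrite -vu.
      exact: le_trans sl (bigvee_le lv).
  exists (Sub _ QV : T) => u Au; rewrite SubK; apply: le_bigvee; right.
  by exists u.
- have /asboolP[xt St] := valP t; exists (val t); split=> // z tz Sz.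
  have Qz : Q z by apply/asboolP; split=> //; exact: le_trans xt tz.
  have := tmax (Sub z Qz : T); rewrite SubK => /(_ tz) <-.
  by rewrite SubK.
Qed.

(** Krull's argument: an element maximal among those avoiding [S] is prime, since [s <= p \/ a] and
    [t <= p \/ b] give [s * t <= p \/ a * b]. *)
Lemma prime_avoiding S x :
  S 1 -> (forall s t, S s -> S t -> S (s * t)) ->
  (forall s, S s -> compact_elt s) -> (forall s, S s -> ~ s <= x) ->
  exists p, [/\ prime_elt p, x <= p & forall s, S s -> ~ s <= p].
Proof.
move=> S1 SM cS Sx; have [p [xp Sp pmax]] := exists_max_avoiding cS Sx.
exists p; split=> //; split.
  by apply/proper_eltP => p1; apply: (Sp _ S1); rewrite p1.
move=> a b abp; apply: contrapT => /not_orP[nap nbp].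
have sup c : ~ c <= p -> exists2 s, S s & s <= p `|` c.
  move=> ncp; apply: contrapT => H; apply: ncp.
  suff -> : p = p `|` c by rewrite leUr.
  apply/esym/pmax; first exact: leUl.
  by move=> s Ss sc; apply: H; exists s.
have [s Ss sa] := sup _ nap; have [t St tb] := sup _ nbp.
apply: (Sp _ (SM _ _ Ss St)); apply: le_trans (leM sa tb) _.
by rewrite mlUl leUx leMr mlUr leUx leMl abp.
Qed.

Definition min_prime x p :=
  [/\ prime_elt p, x <= p & forall q, prime_elt q -> x <= q -> q <= p -> q = p].

(** Zorn for the reverse order. The meet of a chain of primes is prime: if [a] is not below [y] and
    [b] is not below [z], then the smaller of [y] and [z] is above neither factor. *)
Lemma exists_min_prime x P : prime_elt P -> x <= P ->
  exists2 p, min_prime x p & p <= P.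
Proof.
move=> prP xP.
pose Q y := `[< [/\ prime_elt y, x <= y & y <= P] >].
pose T := {y : L | Q y}.
have [||||t tmin] := @Zorn T (fun u v => val v <= val u).
- by move=> u; exact: lexx.
- by move=> u v w uv vw; exact: le_trans vw uv.
- by move=> u v uv vu; apply/val_inj/le_anti; rewrite uv vu.
- move=> A totA.
  pose V : set L := [set y | y = P \/ exists2 u, A u & y = val u].
  have VQ y : V y -> [/\ prime_elt y, x <= y & y <= P].
    by case=> [->//|[u _ ->]]; have /asboolP := valP u.
  have VP : V P by left.
  have QV : Q (bigwedge V).
    apply/asboolP; split; last exact: bigwedge_le.
    - split.
        apply/proper_eltP => V1; have [/proper_eltP P1 _] := prP.
        by apply/P1/ge1E; rewrite -V1; exact: bigwedge_le.
      move=> a b abV; apply: contrapT => /not_orP[na nb].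
      have ex c : ~ c <= bigwedge V -> exists2 y, V y & ~ c <= y.
        move=> nc; apply: contrapT => H; apply: nc; apply: le_bigwedge => y Vy.
        by apply: contrapT => cy; apply: H; exists y.
      have [y Vy nay] := ex _ na; have [z Vz nbz] := ex _ nb.
      have tot : y <= z \/ z <= y.
        case: Vy Vz => [->|[u Au ->]] [->|[w Aw ->]]; first by left.
        + by right; have /asboolP[] := valP w.
        + by left; have /asboolP[] := valP u.
        + by have [] := totA _ _ Au Aw; [right|left].
      case: tot => [yz|zy].
        have [[_ pry] _ _] := VQ _ Vy.
        have [/nay//|bley] := pry _ _ (le_trans abV (bigwedge_le Vy)).
        by apply: nbz; exact: le_trans bley yz.
      have [[_ prz] _ _] := VQ _ Vz.
      have [alez|/nbz//] := prz _ _ (le_trans abV (bigwedge_le Vz)).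
      by apply: nay; exact: le_trans alez zy.
    - by apply: le_bigwedge => y /VQ[].
  exists (Sub _ QV : T) => u Au; rewrite SubK; apply: bigwedge_le; right.
  by exists u.
- have /asboolP[pt xt tP] := valP t; exists (val t) => //; split=> // q pq xq qt.
  have Qq : Q q by apply/asboolP; split=> //; exact: le_trans qt tP.
  have := tmin (Sub q Qq : T); rewrite SubK => /(_ qt) <-.
  by rewrite SubK.
Qed.

End MultLatticeTheory.

(** * Principal elements of a quasi-local domain *)

Section QuasiLocalDomain.
Set Implicit Arguments.
Unset Strict Implicit.
Unset Printing Implicit Defensive.
Import Order.TTheory.
Local Open Scope order_scope.
Local Open Scope group_scope.
Context {d : Order.disp_t} {L : multLatticeType d} (m : L).
Context (hC : C_lattice L) (hpg : principally_generated L).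
Context (hdom : lattice_domain L) (hm : quasi_local m).
Implicit Types (a b c e f g p q r s t u w x y z P : L) (E F S : set L).

Lemma bigvee_principal x : bigvee [set e | principal_elt e /\ e <= x] = x.
Proof.
apply/le_anti/andP; split; first by apply: bigvee_le => y [].
have [F pF xF] := hpg x; rewrite {1}xF; apply: bigvee_le => y Fy.
by apply: le_bigvee; split; [exact: pF|rewrite xF; exact: le_bigvee].
Qed.

Lemma le_principal x y :
  (forall e, principal_elt e -> e <= x -> e <= y) -> x <= y.
Proof.
by move=> H; rewrite -(bigvee_principal x); apply: bigvee_le => e []; exact: H.
Qed.

Lemma exists_principal_nle x y :
  ~ x <= y -> exists e, [/\ principal_elt e, e <= x & ~ e <= y].
Proof.
move=> nxy; apply: contrapT => H; apply/nxy/le_principal => e pe ex.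
by apply: contrapT => ney; apply: H; exists e.
Qed.

Lemma le_mul_principal a b y :
  (forall e f, principal_elt e -> principal_elt f -> e <= a -> f <= b ->
    e * f <= y) -> a * b <= y.
Proof.
move=> H; rewrite -(bigvee_principal b) mul_bigvee.
apply: bigvee_le => _ [f [pf fb] <-].
rewrite mlC -(bigvee_principal a) mul_bigvee.
by apply: bigvee_le => _ [e [pe ea] <-]; rewrite mlC; exact: H.
Qed.

Lemma domain0 x y : x * y = \bot -> x = \bot \/ y = \bot.
Proof.
have [_ H] := hdom.
by move=> xy0; have [|/le0E|/le0E] := H x y; rewrite ?xy0 //; [left|right].
Qed.

Lemma domain_neq01 : (\bot : L) <> 1.
Proof. by have [/proper_eltP] := hdom. Qed.

(** The join law with [a = 0] bounds [t] by [(0 : e) \/ b], and [(0 : e) = 0] in a domain. *)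
Lemma mul_le_cancel t b e : principal_elt e -> e <> \bot ->
  t * e <= b * e -> t <= b.
Proof.
move=> pe e0 tb; have := @mul_le_joinP _ _ t \bot b e pe.
rewrite join0x => /(_ tb) /le_trans; apply; rewrite leUx lexx andbT.
have /le0E/domain0[->|//] := residual_mul_le (\bot : L) e.
exact: le0x.
Qed.

Lemma mul_cancel a b e : principal_elt e -> e <> \bot -> a * e = b * e -> a = b.
Proof.
by move=> pe e0 ab; apply/le_anti/andP; split; apply: (mul_le_cancel pe e0); rewrite ab.
Qed.

(** Since [1] is compact, [x] lies below an element maximal among those other than [1], and this can
    only be [m]. *)
Lemma proper_le x : x <> 1 -> x <= m.
Proof.
move=> x1; have [c1 [mm mu]] := hm.
have [_ ->||y [xy n1y ymax]] := @exists_max_avoiding _ _ [set 1] x.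
- exact: c1.
- by move=> _ -> /ge1E.
have /mu -> // : maximal_elt y; split.
  by apply/proper_eltP => y1; apply: (n1y 1) => //; rewrite y1.
move=> z yz _; apply: contrapT => z1.
have zy : z = y by apply: ymax (ltW yz) _ => _ -> /ge1E.
by rewrite zy ltxx in yz.
Qed.

Lemma max_neq1 : m <> 1.
Proof. by have [_ [[/proper_eltP]]] := hm. Qed.

Lemma proper_leP x : x <> 1 <-> x <= m.
Proof. by split=> [/proper_le//|xm x1]; apply/max_neq1/ge1E; rewrite -x1. Qed.

Lemma max_prime : prime_elt m.
Proof.
split; first by apply/proper_eltP/max_neq1.
move=> a b abm; have [a1|/proper_le] := pselect (a = 1); last by left.
by right; rewrite -(mul1g b) -a1.
Qed.

Lemma prime_le p : prime_elt p -> p <= m.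
Proof. by move=> [/proper_eltP/proper_le]. Qed.

Lemma nakayama e : principal_elt e -> e <= m * e -> e = \bot.
Proof.
move=> pe ele; apply: contrapT => e0; apply: max_neq1; apply: ge1E.
by apply: (mul_le_cancel pe e0); rewrite mul1g.
Qed.

(* Otherwise every f in F would be (f : e)e with (f : e) <= m. *)
Lemma principal_join_irreducible e F :
  principal_elt e -> e <> \bot -> e = bigvee F -> F e.
Proof.
move=> pe e0 eF; apply: contrapT => nFe; apply/e0/nakayama => //.
rewrite {1}eF; apply: bigvee_le => f Ff.
have fe : f <= e by rewrite eF; exact: le_bigvee.
rewrite -(residual_mulK pe fe) leM2r //; apply: proper_le => r1.
by apply: nFe; rewrite -(mul1g e) -r1 residual_mulK.
Qed.

(** A nonzero principal [e] is a join of members of the generating set [C] of compact elements,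
    hence is one of them. *)
Lemma principal_compact e : principal_elt e -> compact_elt e.
Proof.
move=> pe; have [->|e0] := pselect (e = \bot); first exact: compact0.
have [C [_ cC /(_ e)[F FC eF]]] := hC.
by apply: cC; apply: FC; exact: principal_join_irreducible.
Qed.

(** Irreducibility gives [x * y = e * y] for a single principal [e <= x]; then
    [x * (x * y) = e * (x * y)], and [x * y] cancels. *)
Lemma principal_factor x y :
  principal_elt (x * y) -> x * y <> \bot -> principal_elt x.
Proof.
move=> pxy xy0.
have xyE : x * y = bigvee [set z | exists e, [/\ principal_elt e, e <= x & z = e * y]].
  rewrite mlC -{1}(bigvee_principal x) mul_bigvee; congr bigvee.
  apply/seteqP; split=> [_ [e [pe ex] <-]|_ [e [pe ex ->]]].
    by exists e; rewrite mlC.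
  by exists e; rewrite // mlC.
have [e [pe ex xye]] := principal_join_irreducible pxy xy0 xyE.
suff -> : x = e by [].
by apply: (mul_cancel pxy xy0); rewrite mlCA xye mlCA.
Qed.

(** * Localization at a prime element *)

(* The contraction to L of the localization of b at P. *)
Definition sat P b : L :=
  bigvee [set x | exists s, [/\ principal_elt s, ~ s <= P & s * x <= b]].

Lemma sat_intro P b x s : principal_elt s -> ~ s <= P -> s * x <= b -> x <= sat P b.
Proof. by move=> ps sP sx; apply: le_bigvee; exists s. Qed.

Lemma prime_mulN P s t : prime_elt P -> ~ s <= P -> ~ t <= P -> ~ s * t <= P.
Proof. by move=> [_ H] sP tP /H[]. Qed.

Lemma prime_not1 P : prime_elt P -> ~ 1 <= P.
Proof. by move=> [/proper_eltP P1 _] /ge1E. Qed.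

(** Compactness leaves finitely many summands, and the product of their denominators serves for all
    of them. *)
Lemma sat_elim P b x : prime_elt P -> compact_elt x -> x <= sat P b ->
  exists s, [/\ principal_elt s, ~ s <= P & s * x <= b].
Proof.
move=> prP cx /cx[E [/finite_seqP[l ->] lsat xl]].
have {lsat} lsat y : y \in l ->
    exists s, [/\ principal_elt s, ~ s <= P & s * y <= b] by move=> /lsat.
suff [s [ps sP sl]] : exists s,
    [/\ principal_elt s, ~ s <= P & forall y, y \in l -> s * y <= b].
  exists s; split=> //; apply: le_trans (leM2l s xl) _; rewrite mul_bigvee.
  by apply: bigvee_le => _ [y yl <-]; exact: sl.
elim: l lsat {xl} => [_|y l IH lsat].
  by exists 1; split=> //; [exact: principal1|exact: prime_not1].
have [|s [ps sP sl]] := IH.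
  by move=> z zl; apply: lsat; rewrite inE zl orbT.
have [|t [pt tP ty]] := lsat y; first exact: mem_head.
exists (s * t); split; [exact: principalM|exact: prime_mulN|].
move=> z; rewrite inE => /predU1P[->|/sl zs]; rewrite ?[s * t]mlC -mulgA.
- by rewrite mlCA; apply: le_trans (leMl _ _) ty.
- by apply: le_trans (leMl _ _) zs.
Qed.

Lemma le_sat P b : prime_elt P -> b <= sat P b.
Proof.
move=> prP; apply: (sat_intro principal1); last by rewrite mul1g.
exact: prime_not1.
Qed.

Lemma sat_sub P a b : prime_elt P -> a <= sat P b -> sat P a <= sat P b.
Proof.
move=> prP ab; apply: bigvee_le => x [s [ps sP sx]].
apply: le_principal => e pe ex.
have se : s * e <= sat P b by apply: le_trans (leM2l s ex) (le_trans sx ab).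
have [t [pt tP tse]] := sat_elim prP (principal_compact (principalM ps pe)) se.
apply: (sat_intro (principalM pt ps)); first exact: prime_mulN.
by rewrite -mulgA.
Qed.

Lemma satM P a b : prime_elt P -> sat P a * sat P b <= sat P (a * b).
Proof.
have aux x y : x * sat P y <= sat P (x * y).
  rewrite mul_bigvee; apply: bigvee_le => _ [z [s [ps sP sz]] <-].
  by apply: (sat_intro ps sP); rewrite mlCA leM2l.
move=> prP; apply: le_trans (aux _ _) (sat_sub prP _).
by rewrite mlC (mlC a); exact: aux.
Qed.

(** * TA-elements, minimal primes and factorizations near a prime *)

Lemma min_prime_power x P c : min_prime x P -> principal_elt c -> c <= P ->
  exists s n, [/\ principal_elt s, ~ s <= P & s * c ^+ n <= x].
Proof.
move=> [prP xP minP] pc cP.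
(* If no member of [S] is below [x], a prime above [x] avoiding [S] lies below [P] (take [n = 0]),
   so it equals [P] by minimality; but [c] is in [S]. *)
pose S : set L := [set z | exists s n,
  [/\ principal_elt s, ~ s <= P & z = s * c ^+ n]].
apply: contrapT => H.
have [|||z Sz zx|p [prp xp Sp]] := @prime_avoiding _ _ S x.
- by exists 1, 0; split; [exact: principal1|exact: prime_not1|rewrite mul1g].
- move=> _ _ [s [k [ps sP ->]]] [t [n [pt tP ->]]].
  exists (s * t), (k + n)%N; split; [exact: principalM|exact: prime_mulN|].
  by rewrite expgnDr -!mulgA (mlCA _ t).
- move=> _ [s [n [ps _ ->]]]; apply: principal_compact.
  exact/principalM/principalX.
- by have [s [n [ps sP zE]]] := Sz; apply: H; exists s, n; rewrite -zE.
have pP : p <= P.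
  apply: le_principal => e pe ep; apply: contrapT => neP.
  by apply: (Sp e) => //; exists e, 0; rewrite expg0 mulg1.
apply: (Sp c); last by rewrite (minP _ prp xp pP).
by exists 1, 1%N; split; [exact: principal1|exact: prime_not1|rewrite mul1g].
Qed.

Lemma TA_power y s c n : TA_elt y -> s * c ^+ n <= y -> s * c <= y \/ c * c <= y.
Proof.
move=> [_ TA]; elim: n => [|[|n] IH]; [|by left|].
  by rewrite mulg1 => sy; left; exact: le_trans (leMr _ _) sy.
have -> : s * c ^+ n.+2 = s * c ^+ n * c * c by rewrite !expgSr !mulgA.
move=> /TA[|cc|].
- by rewrite -mulgA -expgSr => /IH.
- by right.
- by rewrite -mulgA -expgSr => /IH.
Qed.

(** Locally, each principal [c <= P] has [c <= y] or [c * c <= y]. When the squares of [c] and [f]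
    are both below [y], the TA-property for [c], [f] and [c \/ f] gives [c * f <= y]. *)
Lemma TA_sq_sat y P : TA_elt y -> min_prime y P -> P * P <= sat P y.
Proof.
move=> TAy minP; have [prP yP _] := minP.
have sq c : principal_elt c -> c <= P ->
    exists s, [/\ principal_elt s, ~ s <= P & s * c <= y \/ c * c <= y].
  move=> pc cP; have [s [n [ps sP scy]]] := min_prime_power minP pc cP.
  by exists s; split=> //; exact: TA_power scy.
apply: le_mul_principal => c f pc pf cP fP.
have [s [ps sP]] := sq _ pc cP; have [t [pt tP]] := sq _ pf fP.
have aux z u v : z * u <= y -> z * (u * v) <= y.
  by move=> zu; rewrite mulgA; apply: le_trans (leMr _ _) zu.
move=> [tf _|ff [sc|cc]].
- by apply: (sat_intro pt tP); rewrite (mlC c) aux.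
- by apply: (sat_intro ps sP); exact: aux.
apply: le_trans _ (le_sat y prP).
have [_ TA] := TAy.
have [|||] := TA c f (c `|` f).
- rewrite mlUr leUx mlAC (le_trans (leMr _ _) cc) /=.
  by rewrite -mulgA (le_trans (leMl _ _) ff).
- by [].
- by rewrite mlUr leUx => /andP[]; rewrite mlC.
- by rewrite mlUr leUx => /andP[].
Qed.

(** Two factors below [P] put the product below [P * P]; otherwise exactly one factor [y] is below
    [P], and primality keeps the cofactor outside. *)
Lemma prod_factor_sq P x (Q : L -> Prop) : prime_elt P -> finite_prod_of Q x ->
  x <= P -> x <= P * P \/ exists y r, [/\ Q y, y <= P, ~ r <= P & x = y * r].
Proof.
move=> prP [l [+ ->]]; elim: l => [_|y l IH Ql].
  by rewrite big_nil => /(prime_not1 prP).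
have Qy : Q y by apply: Ql; rewrite mem_head.
rewrite big_cons; set r := \prod_(z <- l) z => yrP.
have {}IH := IH (fun z zl => Ql z (mem_behead (s := y :: l) zl)).
have [yP|nyP] := pselect (y <= P).
  have [rP|nrP] := pselect (r <= P); first by left; exact: leM.
  by right; exists y, r.
have rP : r <= P by have [_ H] := prP; have [] := H _ _ yrP.
have [rPP|[z [t [Qz zP tP rE]]]] := IH rP.
  by left; exact: le_trans (leMl _ _) rPP.
right; exists z, (y * t); split=> //; first exact: prime_mulN.
by rewrite /r rE mlCA.
Qed.

Lemma TA_factor_principal (Q : L -> Prop) p :
  (forall x, principal_elt x -> finite_prod_of Q x) ->
  prime_elt p -> p <> \bot ->
  exists t, [/\ principal_elt t, Q t, t <> \bot & t <= p].
Proof.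
move=> HQ prp p0; have : ~ p <= \bot by move=> /le0E.
move=> /exists_principal_nle[e [pe ep e0]].
have [l [Ql eE]] := HQ e pe.
elim: l e pe ep e0 Ql eE => [e _ + _ _|y l IH e pe ep e0 Ql].
  by rewrite big_nil => + e1; rewrite e1 => /(prime_not1 prp).
rewrite big_cons => eE; have {}e0 : e <> \bot by move=> E; rewrite E lexx in e0.
rewrite eE in pe ep e0.
have [_ H] := prp; have [yp|rp] := H _ _ ep.
  exists y; split=> //; first exact: principal_factor pe e0.
    by apply: Ql; rewrite mem_head.
  by move=> y0; apply: e0; rewrite y0 mlC mlr0.
apply: IH rp _ _ erefl.
- by apply: (@principal_factor _ y); rewrite mlC.
- by move=> /le0E r0; apply: e0; rewrite r0 mlr0.
- by move=> z zl; apply: Ql; rewrite inE zl orbT.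
Qed.

(** * Primes when compact elements are products of TA-elements *)

Section CompactlyTAFactorial.
Context (hTA : forall x : L, compact_elt x -> finite_prod_of TA_elt x).

Lemma prime_le_sq p P : prime_elt p -> prime_elt P -> p <= P -> p <> P ->
  p <= P * P.
Proof.
move=> prp prP pP npP; have nPp : ~ P <= p.
  by move=> Pp; apply: npP; apply/le_anti; rewrite pP.
have [a [pa aP nap]] := exists_principal_nle nPp.
apply: le_principal => h ph hp.
have paa := principalM pa pa.
(* The cube is chosen because a TA-factor above [a^3] is above [a^2]; then [r * a^2 <= h \/ a * a^2]
   yields [r <= (h : a^2) \/ a <= P]. *)
have cx : compact_elt (h `|` a * (a * a)).
  by apply: compact_join; apply: principal_compact => //; exact: principalM.
have [||] := prod_factor_sq prP (hTA cx).
- by rewrite leUx (le_trans hp pP) (le_trans (leMr _ _) aP).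
- by rewrite leUx => /andP[].
move=> [y [r [[_ TA] yP nrP xE]]].
have xy : a * a * a <= y.
  by rewrite -mulgA; apply: le_trans (leUr _ h) _; rewrite xE leMr.
have aay : a * a <= y by have [] := TA _ _ _ xy.
have : r * (a * a) <= h `|` a * (a * a) by rewrite xE mlC leM2r.
move=> /(mul_le_joinP paa) rle; exfalso; apply: nrP; apply: le_trans rle _.
rewrite leUx aP andbT; apply: le_trans pP.
by apply: residual_prime => //; exact: prime_mulN.
Qed.

Lemma not_idempotent_height_le1 p P : prime_elt p -> p <> \bot ->
  prime_elt P -> p <= P -> p <> P -> P <= sat P (P * P).
Proof.
move=> prp p0 prP pP npP; apply: contrapT.
move=> /exists_principal_nle[g [pg gP ngPP]].
have [|[y [r [TAy yP nrP gE]]]] := prod_factor_sq prP (hTA (principal_compact pg)) gP.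
  by move=> gPP; apply/ngPP/(le_trans gPP)/le_sat.
have nyPP : ~ y <= sat P (P * P).
  by move=> yPP; apply: ngPP; rewrite gE; exact: le_trans (leMr _ _) yPP.
have py : principal_elt y.
  apply: (@principal_factor _ r); rewrite -gE // => g0.
  by apply: ngPP; rewrite g0 le0x.
have y0 : y <> \bot by move=> yE; apply: nyPP; rewrite yE le0x.
have nyP2 : ~ y <= P * P by move=> yPP; exact/nyPP/(le_trans yPP)/le_sat.
(* A smaller prime above [y] would be below [P * P] by [prime_le_sq]. *)
have minP : min_prime y P.
  split=> // q prq yq qP; apply: contrapT => nqP.
  by apply: nyP2; apply: le_trans yq _; exact: prime_le_sq.
have PPy := TA_sq_sat TAy minP.
have pPP := prime_le_sq prp prP pP npP.
have [t [pt TAt t0 tp]] := TA_factor_principal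
  (fun x px => hTA (principal_compact px)) prp p0.
have nyp : ~ y <= p by move=> yp; apply: nyP2; exact: le_trans yp pPP.
(* [p] is below [P * P], which is locally below [y]. This is applied to [t], and then to the
   quotient [u] of [s * t] by [y]. *)
have key u : principal_elt u -> u <= p ->
    exists s, [/\ principal_elt s, ~ s <= P & s * u <= y].
  move=> pu up; apply: sat_elim => //; first exact: principal_compact.
  exact: le_trans up (le_trans pPP PPy).
have [s [ps nsP sty]] := key t pt tp.
have stE := residual_mulK py sty.
set u := residual _ _ in stE.
have s0 : s <> \bot by move=> sE; apply: nsP; rewrite sE le0x.
have st0 : s * t <> \bot by move=> /domain0[].
have pu : principal_elt u.
  by apply: (@principal_factor _ y); rewrite stE //; exact: principalM.
have up : u <= p.
  have [_ H] := prp; have [] // := H u y.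
  by rewrite stE; exact: le_trans (leMl _ _) tp.
have [s' [ps' ns'P s'uy]] := key u pu up.
have le_yy : s' * (s * t) <= y * y by rewrite -stE mulgA leM2r.
have wE := residual_mulK (principalM py py) le_yy.
set w := residual _ _ in wE.
have wyyt : w * y * y <= t by rewrite -mulgA wE mulgA leMl.
have wyt : w * y <= t.
  have [_ TA] := TAt; have [//|yyt|//] := TA _ _ _ wyyt.
  by have [_ H] := prp; have [] := H _ _ (le_trans yyt tp).
(* As [s' * s * t = w * y * y <= t * y], cancelling [t] leaves [s' * s <= y <= P]. *)
apply: (prime_mulN prP ns'P nsP); apply: le_trans yP.
by apply: (mul_le_cancel pt t0); rewrite -mulgA -wE mulgA (mlC y) leM2r.
Qed.

(** Locally at [P], a factor outside [P] is [1], and a factor below [P] lies above [P * P], hence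
    above [P]; idempotence absorbs the product. *)
Lemma min_prime_prod_sat P (l : seq L) : P <= sat P (P * P) ->
  (forall y, y \in l -> TA_elt y) -> min_prime (\prod_(y <- l) y) P ->
  P <= sat P (\prod_(y <- l) y).
Proof.
move=> PPP TAl [prP _ minP].
(* The bound of the product by [P] is dropped for the induction: a tail of [l] may fail it. *)
have {minP}: forall q, prime_elt q -> \prod_(y <- l) y <= q -> q <= P -> q = P.
  exact: minP.
elim: l TAl => [_ _|y l IH TAl minP].
  by rewrite big_nil; apply: le_trans (lel1 _) (le_sat _ prP).
rewrite big_cons in minP *.
have Py : P <= sat P y.
  have [yP|nyP] := pselect (y <= P).
    apply: le_trans PPP (sat_sub prP _); apply: TA_sq_sat.
      by apply: TAl; rewrite mem_head.
    by split=> // q prq yq; apply: minP => //; exact: le_trans (leMr _ _) yq.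
  have [s [ps sy nsP]] := exists_principal_nle nyP.
  by apply: (sat_intro ps nsP); exact: le_trans (leMr _ _) sy.
have Pl : P <= sat P (\prod_(z <- l) z).
  apply: IH => [z zl|q prq lq]; first by apply: TAl; rewrite inE zl orbT.
  by apply: minP => //; exact: le_trans (leMl _ _) lq.
apply: le_trans PPP (sat_sub prP _).
by apply: le_trans (leM Py Pl) (satM _ _ prP).
Qed.

Lemma min_prime_join_height_le1 p P c f : prime_elt p -> p <> \bot -> p <= P ->
  compact_elt c -> c <= p -> principal_elt f -> ~ f <= p ->
  ~ min_prime (c `|` f) P.
Proof.
move=> prp p0 pP cc cp pf nfp minP; have [prP + _] := minP.
rewrite leUx => /andP[_ fP].
have npP : p <> P by move=> pE; apply: nfp; rewrite pE.
have PPP := not_idempotent_height_le1 prp p0 prP pP npP.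
have [l [TAl xE]] := hTA (compact_join cc (principal_compact pf)).
have Px : P <= sat P (c `|` f).
  by rewrite xE; apply: min_prime_prod_sat => //; rewrite -xE.
have fxx : f <= sat P ((c `|` f) * (c `|` f)).
  apply: le_trans fP (le_trans PPP (sat_sub prP _)).
  by apply: le_trans (leM Px Px) (satM _ _ prP).
have [s [ps nsP sf]] := sat_elim prP (principal_compact pf) fxx.
(* In the expanded square every term except [f * f] is below [c]; the join law then gives
   [s <= (c : f) \/ f <= P]. *)
have : s * f <= c `|` f * f.
  apply: le_trans sf _; rewrite mlUr leUx; apply/andP; split.
    by apply: le_trans (leMl _ _) (leUl _ _).
  rewrite mlUl leUx leUr andbT.
  by apply: le_trans (leMr _ _) (leUl _ _).
move=> /(mul_le_joinP pf) sle; apply: nsP; apply: le_trans sle _.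
by rewrite leUx fP andbT; apply: le_trans pP; exact: residual_prime.
Qed.
End CompactlyTAFactorial.

(** * Minimal primes of a TA-element and the height bound *)

Lemma compact_avoid2 p q r : ~ p <= q -> ~ p <= r ->
  exists x, [/\ compact_elt (x * x), x <= p, ~ x <= q & ~ x <= r].
Proof.
move=> /exists_principal_nle[a [pa ap naq]] /exists_principal_nle[b [pb bp nbr]].
exists (a `|` b); split.
- rewrite mlUr !mlUl; apply: compact_join; apply: compact_join;
    by apply/principal_compact/principalM.
- by rewrite leUx ap.
- by rewrite leUx => /andP[].
- by rewrite leUx => /andP[].
Qed.

(** Pick [x1 <= p1] and [x2 <= p2], each outside the other minimal prime and outside [P]. Localizing
    gives [c2 * x1 <= e] with [c2] outside [p1], and [c1 * x2 <= e] with [c1] outside [p2]. Then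
    [(c1 \/ c2) * x1 * x2 <= e], and every outcome of the TA-property contradicts one of the three
    primes. *)
Lemma TA_min_prime2 e p1 p2 P : TA_elt e -> min_prime e p1 -> min_prime e p2 ->
  p1 <> p2 -> prime_elt P -> e <= P -> p1 <= P \/ p2 <= P.
Proof.
move=> TAe min1 min2 np12 prP eP; apply: contrapT => /not_orP[np1P np2P].
have [pr1 e1 H1] := min1; have [pr2 e2 H2] := min2.
have n12 : ~ p1 <= p2 by move=> p12; apply: np12; exact: H2.
have n21 : ~ p2 <= p1 by move=> p21; apply: np12; apply/esym; exact: H1.
have [_ TA] := TAe.
have aux p q x : min_prime e p -> x <= p -> compact_elt (x * x) ->
    prime_elt q -> e <= q -> ~ x <= q -> exists2 c, ~ c <= p & c * x <= e.
  move=> minp xp cxx prq eq nxq; have [prp _ _] := minp.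
  have [s [_ nsp sxx]] : exists s, [/\ principal_elt s, ~ s <= p & s * (x * x) <= e].
    apply: sat_elim => //.
    by apply: le_trans (leM xp xp) (TA_sq_sat TAe minp).
  rewrite mulgA in sxx; exists s => //.
  have [//|xxe|//] := TA _ _ _ sxx.
  by have := prime_mulN prq nxq nxq (le_trans xxe eq).
have [x1 [cx1 x1p x1n2 x1nP]] := compact_avoid2 n12 np1P.
have [x2 [cx2 x2p x2n1 x2nP]] := compact_avoid2 n21 np2P.
have [c2 c2n1 c2x1] := aux _ _ _ min1 x1p cx1 pr2 e2 x1n2.
have [c1 c1n2 c1x2] := aux _ _ _ min2 x2p cx2 pr1 e1 x2n1.
have [|||] := TA (c1 `|` c2) x1 x2.
- rewrite mlUl mlUl leUx mlAC (le_trans (leMr _ _) c1x2) /=.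
  exact: le_trans (leMr _ _) c2x1.
- rewrite mlUl leUx => /andP[c1x1 _].
  exact: (prime_mulN pr2 c1n2 x1n2 (le_trans c1x1 e2)).
- by move=> /le_trans/(_ eP); exact: prime_mulN.
- rewrite mlUl leUx => /andP[_ c2x2].
  exact: (prime_mulN pr1 c2n1 x2n1 (le_trans c2x2 e1)).
Qed.

(** The form of dimension at most one used in the arguments; [height_le1P] matches it with
    [krull_dim]. *)
Definition height_le1 := forall p, prime_elt p -> p <> \bot -> p = m.

Lemma CTAFL_height_le1 :
  (forall x : L, compact_elt x -> finite_prod_of TA_elt x) -> height_le1.
Proof.
move=> hTA q prq q0; apply: contrapT => nqm.
have [e [pe TAe e0 eq]] := TA_factor_principal
  (fun x px => hTA x (principal_compact px)) prq q0.
have ne x : e <= x -> x <> \bot by move=> ex x0; apply/e0/le0E; rewrite -x0.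
have [p1 min1 p1q] := exists_min_prime prq eq.
have [pr1 e1 H1] := min1.
have n1 : ~ m <= p1.
  by move=> mp; apply: nqm; apply/le_anti; rewrite (le_trans mp p1q) prime_le.
(* If [p1] is below every prime above [e], then [p2] is [p1] again; otherwise it is a second minimal
   prime. *)
have [p2 [pr2 e2 n2 cov]] : exists p2, [/\ prime_elt p2, e <= p2, ~ m <= p2 &
    forall P, prime_elt P -> e <= P -> p1 <= P \/ p2 <= P].
  have [|] := pselect (exists2 P, prime_elt P /\ e <= P & ~ p1 <= P); last first.
    move=> H; exists p1; split=> // P prP eP; left.
    by apply: contrapT => npP; apply: H; exists P.
  move=> [P [prP eP] npP]; have [p2 min2 p2P] := exists_min_prime prP eP.
  have [pr2 e2 H2] := min2; have n12 : p1 <> p2.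
    by move=> p12; apply: npP; rewrite p12.
  exists p2; split=> //; last by move=> R; exact: TA_min_prime2.
  move=> mp2; apply: n12; apply: H2 => //.
  exact: le_trans (prime_le pr1) mp2.
have hj := min_prime_join_height_le1 hTA.
have ce := principal_compact pe.
have [[f [pf fm nf1 nf2]]|H] := pselect (exists f,
    [/\ principal_elt f, f <= m, ~ f <= p1 & ~ f <= p2]).
  have [|P minP _] := exists_min_prime (x := e `|` f) max_prime.
    by rewrite leUx fm (le_trans eq (prime_le prq)).
  have [prP xP _] := minP; have eP : e <= P := le_trans (leUl _ _) xP.
  have [p1P|p2P] := cov P prP eP.
    exact: (hj p1 P e f pr1 (ne _ e1)).
  exact: (hj p2 P e f pr2 (ne _ e2)).
(* Now [f1 \/ f2] avoids both primes but no principal element does. According to the prime found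
   below [P], one of [f1], [f2] is the principal part and the other joins [e] in the compact
   part. *)
have [f1 [pf1 f1m nf11]] := exists_principal_nle n1.
have [f2 [pf2 f2m nf22]] := exists_principal_nle n2.
have f12 : f1 <= p2 by apply: contrapT => nf; apply: H; exists f1.
have f21 : f2 <= p1 by apply: contrapT => nf; apply: H; exists f2.
have [|P minP _] := exists_min_prime (x := e `|` f2 `|` f1) max_prime.
  by rewrite !leUx f2m f1m (le_trans eq (prime_le prq)).
have [prP xP _] := minP.
have eP : e <= P by apply: le_trans xP; rewrite -joinA leUl.
have [p1P|p2P] := cov P prP eP.
  apply: (hj p1 P (e `|` f2) f1 pr1 (ne _ e1)) => //.
    by apply: compact_join => //; exact: principal_compact.
  by rewrite leUx e1.
apply: (hj p2 P (e `|` f1) f2 pr2 (ne _ e2)) => //.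
- by apply: compact_join => //; exact: principal_compact.
- by rewrite leUx e2.
- by rewrite -joinA (joinC f1) joinA.
Qed.

(** * Comparability of [m ^+ 2] and the powers of [m] *)

Definition max_sq_comparable :=
  comparable_elt (m ^+ 2) /\ bigwedge [set m ^+ n | n in [set: nat]] = \bot.

Lemma TA_ge_sq y : height_le1 -> TA_elt y -> y <> \bot -> m * m <= y.
Proof.
move=> h1 TAy y0; have [/proper_eltP/proper_le ym _] := TAy.
have minm : min_prime y m.
  split=> //; first exact: max_prime.
  by move=> q prq yq _; apply: h1 => // q0; apply: y0; apply: le0E; rewrite -q0.
apply: le_trans (TA_sq_sat TAy minm) _.
(* Only [1] is outside [m], so localizing at [m] changes nothing. *)
apply: bigvee_le => x [s [_ nsm]].
have -> : s = 1 by apply: contrapT => /proper_le.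
by rewrite mul1g.
Qed.

Lemma prod_ge_power (Q : L -> Prop) x z : (forall y, Q y -> y <> \bot -> z <= y) ->
  finite_prod_of Q x -> x <> \bot -> exists n, z ^+ n <= x.
Proof.
move=> Qz [l [Ql ->]]; elim: l Ql => [_ _|y l IH Ql].
  by exists 0; rewrite big_nil expg0.
rewrite big_cons => yl0.
have [|n zn] := IH (fun z zl => Ql z (mem_behead (s := y :: l) zl)).
  by move=> l0; apply: yl0; rewrite l0 mlr0.
exists n.+1; rewrite expgS leM //; apply: Qz.
  by apply: Ql; rewrite mem_head.
by move=> y0; apply: yl0; rewrite y0 mlC mlr0.
Qed.

Lemma PTAFL_max_sq_comparable : height_le1 ->
  (forall x : L, principal_elt x -> finite_prod_of TA_elt x) -> max_sq_comparable.
Proof.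
move=> h1 hTA; split.
  move=> b; have [|nb] := pselect (m ^+ 2 <= b); first by left.
  right; apply: le_principal => f pf fb; rewrite expg2.
  have [->|f0] := pselect (f = \bot); first exact: le0x.
  have nf : ~ m * m <= f by move=> mf; apply: nb; exact: le_trans mf fb.
  have f1 : f <> 1 by move=> fE; apply: nf; rewrite fE lel1.
  (* Unless [f <= m * m], the cofactor outside [m] is [1], so [f] itself is a nonzero TA-element and
     lies above [m * m]. *)
  have [//|[y [r [TAy ym nrm fE]]]] :=
    prod_factor_sq max_prime (hTA f pf) (proper_le f1).
  have r1 : r = 1 by apply: contrapT => /proper_le.
  by exfalso; apply: nf; rewrite fE r1 mulg1; apply: TA_ge_sq => // y0;
    apply: f0; rewrite fE y0 mlC mlr0.
apply: contrapT => b0.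
have nb : ~ bigwedge [set m ^+ n | n in [set: nat]] <= \bot by move=> /le0E.
have [e [pe eb ne0]] := exists_principal_nle nb.
have e0 : e <> \bot by move=> eE; rewrite eE lexx in ne0.
have em n : e <= m ^+ n by apply: le_trans eb (bigwedge_le _); exists n.
have [n mn] := prod_ge_power (fun y => TA_ge_sq h1) (hTA e pe) e0.
apply: e0; apply: nakayama => //.
(* Since [(m * m) ^+ n <= e], the exponent [2n + 1] gives [e <= m * e]. *)
apply: le_trans (em (2 * n).+1) _; rewrite expgS leM2l //.
by rewrite expgnA expg2.
Qed.

Lemma max_sq_comparable_shape x :
  max_sq_comparable -> x <> \bot -> x <> 1 -> ~ m ^+ 2 <= x ->
  exists e y n, [/\ e <= m, m ^+ 2 <= e, m ^+ 2 <= y & x = y * e ^+ n.+1].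
Proof.
move=> [cmp m0] x0 x1 nx; have xm2 : x <= m ^+ 2 by have [] := cmp x.
have nmm : ~ m <= m ^+ 2.
  rewrite expg2 => mm; apply: x0; apply: le0E; rewrite -m0.
  apply: le_bigwedge => _ [n _ <-]; apply: le_trans xm2 _.
  elim: n => [|n IH]; first exact: lel1.
  by rewrite (expgS m n); apply: le_trans (leM2l m IH); rewrite expg2 leM2l.
have [e [pe em ne2]] := exists_principal_nle nmm.
have m2e : m ^+ 2 <= e by have [] := cmp e.
have mme : m ^+ 2 = m * e.
  apply/le_anti/andP; split; last by rewrite expg2 leM2l.
  rewrite -(residual_mulK pe m2e) leM2r //.
  apply: proper_le => r1; apply: ne2.
  by rewrite -(mul1g e) -r1 residual_mulK.
have mSe n : m ^+ n.+1 = m * e ^+ n.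
  elim: n => [|n IH]; first by rewrite expg0 mulg1.
  by rewrite expgS IH mulgA -expg2 mme -mulgA -expgS.
have [n nxn] : exists n, ~ x <= m ^+ n.
  apply: contrapT => H; apply: x0; apply: le0E; rewrite -m0.
  apply: le_bigwedge => _ [n _ <-]; apply: contrapT => nx'; apply: H.
  by exists n.
(* The smallest power of [m] above [x] has exponent [k + 2]; the offset comes from [x <= m ^+ 2]. *)
have [k [xk nxk]] : exists k, x <= m ^+ k.+2 /\ ~ x <= m ^+ k.+3.
  apply: contrapT => H; apply: nxn.
  suff xk k : x <= m ^+ k.+2.
    case: n => [|[|n]]; [exact: lel1| |exact: xk].
    by rewrite expg1; exact: proper_le.
  elim: k => // k IH; apply: contrapT => nk; by apply: H; exists k; rewrite IH.
have pek := principalX k.+1 pe.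
have xe : x <= e ^+ k.+1 by apply: le_trans xk _; rewrite mSe leMl.
have xE := residual_mulK pek xe.
exists e, (residual x (e ^+ k.+1)), k; split=> //.
(* A residual below [m^2] would give [x <= m^2 * e^(k+1) = m^(k+3)], against the choice of [k]. *)
have [//|ym] := cmp (residual x (e ^+ k.+1)).
exfalso; apply: nxk; rewrite -xE mSe (expgS e k.+1) mulgA -mme.
exact: leM2r.
Qed.

Lemma OA_of_ge_sq x : m ^+ 2 <= x -> x <> 1 -> OA_elt x.
Proof.
move=> mx x1; split; first exact/proper_eltP.
move=> a b c /proper_le am /proper_le bm _ _; left.
by apply: le_trans mx; rewrite expg2 leM.
Qed.

Lemma OA_bot : OA_elt (\bot : L).
Proof.
split; first exact/proper_eltP/domain_neq01.
by move=> a b c _ _ _; have [_ H] := hdom; move=> /H.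
Qed.

Lemma max_sq_comparable_OAFL x : max_sq_comparable -> finite_prod_of OA_elt x.
Proof.
have single y : OA_elt y -> finite_prod_of OA_elt y.
  move=> OAy; exists [:: y]; split; last by rewrite big_seq1.
  by move=> z; rewrite inE => /eqP ->.
have [->|x1] := pselect (x = 1).
  by exists [::]; rewrite big_nil.
have [->|x0] := pselect (x = \bot); first by move=> _; exact/single/OA_bot.
have [mx|nmx] := pselect (m ^+ 2 <= x).
  by move=> _; apply: single; exact: OA_of_ge_sq.
move=> h7; have [e [y [n [em m2e m2y ->]]]] := max_sq_comparable_shape h7 x0 x1 nmx.
have OAe : OA_elt e by apply: OA_of_ge_sq => //; apply/proper_leP.
have enE : e ^+ n.+1 = \prod_(z <- nseq n.+1 e) z.
  elim: n.+1 => [|k IH]; first by rewrite big_nil expg0.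
  by rewrite expgS IH big_cons.
have [->|y1] := pselect (y = 1).
  exists (nseq n.+1 e); rewrite mul1g; split=> // z.
  by rewrite mem_nseq => /andP[_ /eqP ->].
exists (y :: nseq n.+1 e); rewrite big_cons -enE; split=> // z.
rewrite inE mem_nseq => /predU1P[->|/andP[_ /eqP ->] //].
exact: OA_of_ge_sq.
Qed.

(** A nonzero prime not above [m^2] has the form [y * e^(n+1)], so it is above [y] or [e], and both
    of these are above [m^2]. *)
Lemma max_sq_comparable_height_le1 : max_sq_comparable -> height_le1.
Proof.
move=> h7 p prp p0; apply/le_anti; rewrite prime_le //=.
have [/proper_eltP p1 H] := prp.
have sq : m ^+ 2 <= p -> m <= p by rewrite expg2 => /H[].
have [/sq //|nmp] := pselect (m ^+ 2 <= p); apply: sq.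
have [e [y [n [em m2e m2y pE]]]] := max_sq_comparable_shape h7 p0 p1 nmp.
have : y * e ^+ n.+1 <= p by rewrite -pE.
move=> /H[|ep]; first exact: le_trans.
apply: le_trans m2e _.
elim: n.+1 ep => [/(prime_not1 prp)//|k IH].
by rewrite expgS => /H[].
Qed.

Lemma OA_TA x : OA_elt x -> TA_elt x.
Proof.
move=> [x1 H]; split=> // a b c.
have [->|a1] := pselect (a = 1); first by rewrite !mul1g; constructor 2.
have [->|b1] := pselect (b = 1); first by rewrite !mulg1; constructor 3.
have [->|c1] := pselect (c = 1); first by rewrite !mulg1; constructor 1.
move=> /(H _ _ _ a1 b1 c1)[abx|cx]; first by constructor 1.
by constructor 2; exact: le_trans (leMl _ _) cx.
Qed.

Lemma finite_prod_ofS (Q R : L -> Prop) x : (forall y, Q y -> R y) ->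
  finite_prod_of Q x -> finite_prod_of R x.
Proof. by move=> QR [l [Ql ->]]; exists l; split=> // y /Ql /QR. Qed.

End QuasiLocalDomain.

(** * Krull dimension *)

Section KrullDimension.
Set Implicit Arguments.
Unset Strict Implicit.
Unset Printing Implicit Defensive.
Import Order.TTheory.

(** [supremum] falls back on its default when no supremum exists, so existence in [\bar int] must be
    shown: a natural number for bounded sets, [+oo] otherwise. *)
Lemma supremums_nat_ereal (A : set nat) (n0 : nat) : A n0 ->
  supremums [set (n%:Z)%:E | n in A] !=set0.
Proof.
move=> An0; have [[M AM]|unb] := pselect (exists M, ubound A M).
  have [s [As sA]] : supremums A !=set0.
    by apply: nat_supremums_neq0; exists M.
  exists (s%:Z)%:E; split=> [_ [n An <-]|[r||] ub].
  - by rewrite lee_fin lez_nat; exact: As.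
  - have nr n : A n -> ((n%:Z : int) <= r)%O.
      by move=> An; rewrite -lee_fin; apply: ub; exists n.
    case: r {ub} nr => [k|k] nr; last by have := nr _ An0.
    by rewrite lee_fin lez_nat; apply: sA => n /nr; rewrite lez_nat.
  - by rewrite leey.
  - have : (((n0%:Z)%:E : \bar int) <= -oo)%E by apply: ub; exists n0.
    by rewrite leeNy_eq.
exists +oo%E; split=> [_ [n An <-]|[r||] ub]; first by rewrite leey.
- case: unb; exists `|r|%N => n An.
  have : (((n%:Z)%:E : \bar int) <= r%:E)%E by apply: ub; exists n.
  by rewrite lee_fin; case: (r) => k //; rewrite lez_nat.
- by [].
- have : (((n0%:Z)%:E : \bar int) <= -oo)%E by apply: ub; exists n0.
  by rewrite leeNy_eq.
Qed.

Context {d : Order.disp_t} {L : multLatticeType d}.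

Lemma prime_chain_le_krull_dim n :
  prime_chain_length L n -> (((n%:Z)%:E : \bar int) <= krull_dim L)%E.
Proof.
move=> Ln; rewrite /krull_dim /supremum.
have Sn : [set (k%:Z)%:E | k in prime_chain_length L] (n%:Z)%:E by exists n.
case: ifPn => [/eqP S0|_]; first by rewrite S0 in Sn.
have [ub _] : supremums [set (k%:Z)%:E | k in prime_chain_length L]
    (xget -oo%E (supremums [set (k%:Z)%:E | k in prime_chain_length L])).
  by apply: xgetPex; exact: supremums_nat_ereal Ln.
exact: ub.
Qed.

Lemma krull_dim_le n : (forall k, prime_chain_length L k -> (k <= n)%N) ->
  (krull_dim L <= ((n%:Z)%:E : \bar int))%E.
Proof.
move=> Ln; rewrite /krull_dim /supremum; case: ifPn => _; first exact: leNye.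
case: xgetP => [y _ [_ ub]|_]; last exact: leNye.
by apply: ub => _ [k /Ln kn <-]; rewrite lee_fin lez_nat.
Qed.

Context (m : L).
Context (hdom : lattice_domain L) (hm : quasi_local m).

Lemma height_le1P : height_le1 m <-> (krull_dim L <= 1)%E.
Proof.
split=> [h1|dim1 p prp p0].
  apply: (@krull_dim_le 1) => k [s [sk]].
  case: s sk => [//|x [|y [|z s]]] [<-] //= /and3P[xy yz _] prs.
  have nz u v : (u < v)%O -> v <> (\bot : L)%O.
    by move=> uv v0; rewrite v0 ltx0 in uv.
  have ym : y = m by apply: h1; [apply: prs; rewrite !inE eqxx orbT|exact: nz xy].
  have zm : z = m by apply: h1; [apply: prs; rewrite !inE eqxx !orbT|exact: nz yz].
  by rewrite ym zm ltxx in yz.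
apply: contrapT => npm.
have : prime_chain_length L 2.
  exists [:: (\bot)%O; p; m]; split=> //=.
    rewrite lt0x andbT !lt_neqAle prime_le // andbT.
    by apply/andP; split; apply/eqP.
  move=> q; rewrite !inE => /or3P[] /eqP -> //.
  exact: max_prime hm.
by move=> /prime_chain_le_krull_dim /le_trans/(_ dim1).
Qed.

Lemma height_le1_ACC : height_le1 m -> ACC_primes L.
Proof.
move=> h1 p prp pS.
have pmono k n : (k <= n)%N -> (p k <= p n)%O.
  by move=> /subnK <-; elim: (n - k)%nat => [//|j IH]; apply: le_trans IH (pS _).
have [[N pN]|H] := pselect (exists N, p N <> (\bot)%O).
  exists N => n Nn; rewrite (h1 _ (prp N) pN); apply: h1 => // pn0.
  by apply: pN; apply: le0E; rewrite -pn0 pmono.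
have p0 n : p n = (\bot)%O by apply: contrapT => pn; apply: H; exists n.
by exists 0 => n _; rewrite !p0.
Qed.

End KrullDimension.

(** * The cycle of implications *)

Theorem theorem4p15 (d : Order.disp_t) (L : multLatticeType d) (m : L)
    (hC : C_lattice L) (hpg : principally_generated L)
    (hdom : lattice_domain L) (hm : quasi_local m) :
  [<-> OAFL L;
       TAFL L;
       COAFL L;
       CTAFL L /\ ACC_primes L;
       (krull_dim L <= 1)%E /\ POAFL L;
       (krull_dim L <= 1)%E /\ PTAFL L;
       comparable_elt (m ^+ 2)%g /\
         bigwedge [set (m ^+ n)%g | n in [set: nat]] = (\bot : L)%O].
Proof.
have OA_TA_prod (x : L) : finite_prod_of OA_elt x -> finite_prod_of TA_elt x.
  by apply: finite_prod_ofS => y; exact: OA_TA.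
have compact_principal : forall x : L, principal_elt x -> compact_elt x.
  by move=> x; exact: (principal_compact hC hdom hm).
have cond7_of_CTAFL : CTAFL L -> max_sq_comparable m.
  move=> [_ hTA]; apply: (PTAFL_max_sq_comparable hC hpg hdom hm).
    exact: (CTAFL_height_le1 hC hpg hdom hm hTA).
  by move=> x /compact_principal; exact: hTA.
have OAFL_of_7 : max_sq_comparable m -> forall x : L, finite_prod_of OA_elt x.
  by move=> h7 x; exact: (max_sq_comparable_OAFL hpg hdom hm).
have height_of_7 := max_sq_comparable_height_le1 hpg hm.
have dimP := height_le1P hdom hm.
(* In the cycle, the passages from TA-factorizations to OA-factorizations go through the last
   condition, [max_sq_comparable]. *)
tfae.
- by move=> [_ h]; split=> // x; exact/OA_TA_prod.
- move=> [_ h]; split=> // x _; apply: OAFL_of_7.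
  by apply: cond7_of_CTAFL; split.
- move=> [_ h].
  have hT : CTAFL L by split=> // x /h/OA_TA_prod.
  by split=> //; apply: height_le1_ACC (height_of_7 (cond7_of_CTAFL hT)).
- move=> [/cond7_of_CTAFL h7 _]; split; first exact/dimP/height_of_7.
  by split=> // x _; exact: OAFL_of_7.
- by move=> [dim1 [_ h]]; split=> //; split=> // x /h/OA_TA_prod.
- move=> [/dimP h1 [_ h]]; exact: (PTAFL_max_sq_comparable hC hpg hdom hm h1 h).
- by move=> h7; split=> // x; exact: OAFL_of_7.
Qed.
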